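(* Let $E\subset[\frac14,\frac34]^2\times\{\frac12\}$ be a non-trivial planar continuum and let $D=\{d_k : k\in\mathbb{N}\}$ be an enumerated countable dense subset of $E$. Let $\mathcal{E}^{(0)}=\{(E_f,D_f) : f\in\mathbb{N}^{<\mathbb{N}}\}$ be the constant list with $E_f=E$ and $D_f=D$ (with the same enumeration) for every $f\in\mathbb{N}^{<\mathbb{N}}$. Then the space $X_{\mathcal{E}^{(0)}}$ is a non-reconstructible compact metrizable $h$-homogeneous space.
   Context: Conventions: $\mathbb{N}=\{1,2,\dots\}$; $\mathbb{N}^{<\mathbb{N}}$ is the set of finite sequences in $\mathbb{N}$, including the empty sequence $\emptyset$; $\mathbb{N}^n$ is the set of those of length $n$; $f^\frown k$ is $f$ extended by $k$; $I=[0,1]$. A continuum is a compact connected metrizable space; it is non-trivial if it has more than one point. $d_\infty$ is the sup-metric on $\mathbb{R}^3$ and $\overline{B}^\infty_r(c)=\{x\in\mathbb{R}^3 : d_\infty(x,c)\le r\}$. Relativization: for a cube $Q=\overline{B}^\infty_r(c)$ let $a_Q:I^3\to Q$, $a_Q(x)=2r\left(x-(\tfrac12,\tfrac12,\tfrac12)\right)+c$; for $A\subseteq I^3$ write $A|Q=a_Q(A)$. Building block: for a non-trivial continuum $E\subset[\frac14,\frac34]^2\times\{\frac12\}\subset I^3$ and a countable dense enumerated $D=\{d_k : k\in\mathbb{N}\}\subset E$, put $F_k^{E,D}=\overline{B}^\infty_{2^{-2k-1}}\left(d_k+(0,0,2^{-2k})\right)$ and $C_{E,D}=E\cup\bigcup_{k\in\mathbb{N}}F_k^{E,D}\subset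 I^3$. Construction of $X_{\mathcal{E}}$: given a list $\mathcal{E}=\{(E_f,D_f) : f\in\mathbb{N}^{<\mathbb{N}}\}$ of non-trivial continua $E_f\subset[\frac14,\frac34]^2\times\{\frac12\}$ with enumerated countable dense subsets $D_f\subset E_f$, let $X_1=C_{E_\emptyset,D_\emptyset}$ and $F_{\langle k\rangle}=F_k^{E_\emptyset,D_\emptyset}$ for $k\in\mathbb{N}$. Given $X_n$ and cubes $F_f$ for $f\in\mathbb{N}^n$, let $X_{n+1}=\left(X_n\setminus\bigcup_{f\in\mathbb{N}^n}F_f\right)\cup\bigcup_{f\in\mathbb{N}^n}\left(C_{E_f,D_f}|F_f\right)$ and $F_{f^\frown k}=F_k^{E_f,D_f}|F_f$ for $f\in\mathbb{N}^n$, $k\in\mathbb{N}$. Finally $X_{\mathcal{E}}=\bigcap_n X_n$. A space $X$ is $h$-homogeneous if every non-empty clopen subset of $X$ is homeomorphic to $X$. The deck of $X$ is $\mathcal{D}(X)=\{[X\setminus\{x\}] : x\in X\}$, where $[Y]$ is the homeomorphism class of $Y$. $X$ is reconstructible if every topological space $Z$ with $\mathcal{D}(Z)=\mathcal{D}(X)$ is homeomorphic to $X$; non-reconstructible otherwise. *)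

(* Defs.v *)
From HB Require Import structures.
From mathcomp Require Import all_boot all_order all_algebra.
From mathcomp Require Import all_classical all_reals all_analysis.

Set Implicit Arguments.
Unset Strict Implicit.
Unset Printing Implicit Defensive.

Import Order.TTheory GRing.Theory Num.Theory.
Import numFieldNormedType.Exports.

Local Open Scope classical_set_scope.
Local Open Scope ring_scope.

Definition homeomorphic (T U : topologicalType) : Prop :=
  exists (f : T -> U) (g : U -> T),
    [/\ continuous f, continuous g, cancel f g & cancel g f].

(* Classes of spaces are plain predicates because [topologicalType] does not
   fit in the universe of [set]. *)
Definition homeo_class (T : topologicalType) : topologicalType -> Prop :=
  fun U => homeomorphic T U.

(* A subset [A] of a space is regarded as a space through [set_type A], which
   the library endows with the topology induced by the inclusion. *)
Definition deck (T : topologicalType) : (topologicalType -> Prop) -> Prop :=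
  fun C => exists x : T, C = homeo_class (set_type [set~ x]).

Definition reconstructible (T : topologicalType) : Prop :=
  forall Z : topologicalType, deck Z = deck T -> homeomorphic Z T.

Definition h_homogeneous (T : topologicalType) : Prop :=
  forall U : set T, U !=set0 -> clopen U -> homeomorphic (set_type U) T.

Definition metrizable (R : realType) (T : topologicalType) : Prop :=
  exists M : metricType R, homeomorphic T M.

Definition continuum (R : realType) (T : topologicalType) : Prop :=
  [/\ compact [set: T], connected [set: T] & metrizable R T].

Definition nontrivial_space (T : topologicalType) : Prop :=
  exists x y : T, x <> y.

Section Construction.
Variable R : realType.

Local Notation pt := 'rV[R]_3.

Definition vec3 (x y z : R) : pt := \row_(i < 3) [:: x; y; z]`_i.

Definition middle_square : set pt :=
  [set vec3 x y (1 / 2) | x in `[1 / 4, 3 / 4] & y in `[1 / 4, 3 / 4]].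

Record cube := Cube { center : pt; radius : R }.

(* The norm of ['rV[R]_3] is the sup norm. *)
Definition cube_set (Q : cube) : set pt :=
  [set x | `|x - center Q| <= radius Q].

Definition unit_cube : cube := Cube (vec3 (1 / 2) (1 / 2) (1 / 2)) (1 / 2).

Definition cube_map (Q : cube) (x : pt) : pt :=
  (2 * radius Q) *: (x - vec3 (1 / 2) (1 / 2) (1 / 2)) + center Q.

Definition relativize (A : set pt) (Q : cube) : set pt := cube_map Q @` A.

(* The relativization of a cube is again a cube; see [cube_set_relativize]. *)
Definition relativize_cube (P Q : cube) : cube :=
  Cube (cube_map Q (center P)) (2 * radius Q * radius P).

(* Natural numbers are indexed from 0 here and from 1 in the source: [d k]
   stands for d_(k+1), and [block_cube d k] for F_(k+1), whence the [k.+1]. *)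
Definition block_cube (d : nat -> pt) (k : nat) : cube :=
  Cube (d k + vec3 0 0 (2 ^- (2 * k.+1))) (2 ^- (2 * k.+1 + 1)).

Definition block (E : set pt) (d : nat -> pt) : set pt :=
  E `|` \bigcup_k cube_set (block_cube d k).

Variables (E : seq nat -> set pt) (d : seq nat -> nat -> pt).

(* [nested_cube_rev r] is the cube F_f with f the reversal of [r].  Setting
   F_[::] := I^3, whose [cube_map] is the identity, makes the recursion uniform:
   see [nested_cube1] and [nested_cube_rcons]. *)
Fixpoint nested_cube_rev (r : seq nat) : cube :=
  if r is k :: r' then
    relativize_cube (block_cube (d (rev r')) k) (nested_cube_rev r')
  else unit_cube.

Definition nested_cube (f : seq nat) : cube := nested_cube_rev (rev f).

(* [stage n] is X_(n+1). *)
Fixpoint stage (n : nat) : set pt :=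
  if n is m.+1 then
    (stage m `\` \bigcup_(f in [set f : seq nat | size f = m.+1])
                   cube_set (nested_cube f))
    `|` \bigcup_(f in [set f : seq nat | size f = m.+1])
          relativize (block (E f) (d f)) (nested_cube f)
  else block (E [::]) (d [::]).

Definition limit_set : set pt := \bigcap_n stage n.

Lemma cube_mapB (Q : cube) (x y : pt) :
  cube_map Q x - cube_map Q y = (2 * radius Q) *: (x - y).
Proof.
by rewrite /cube_map opprD addrACA subrr addr0 -scalerBr opprB addrA subrK.
Qed.

Lemma cube_set_relativize (P Q : cube) : 0 < radius Q ->
  cube_set (relativize_cube P Q) = relativize (cube_set P) Q.
Proof.
move=> Q0; have Q20 : 0 < 2 * radius Q by rewrite mulr_gt0.
have cubeE x : cube_set (relativize_cube P Q) (cube_map Q x) <-> cube_set P x.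
  by rewrite /cube_set /= cube_mapB normrZ gtr0_norm// ler_pM2l.
apply/seteqP; split => [y yPQ|_ [x /cubeE Px <-] //].
have yE : cube_map Q ((2 * radius Q)^-1 *: (y - center Q) +
    vec3 (1 / 2) (1 / 2) (1 / 2)) = y.
  by rewrite /cube_map addrK scalerA mulfV ?gt_eqF// scale1r subrK.
by move: yPQ; rewrite -{1}yE => /cubeE yP; rewrite -yE; exact: imageP.
Qed.

Lemma nested_cube_rcons f k : nested_cube (rcons f k) =
  relativize_cube (block_cube (d f) k) (nested_cube f).
Proof. by rewrite /nested_cube rev_rcons /= revK. Qed.

Lemma cube_map_unit : cube_map unit_cube =1 id.
Proof.
by move=> x; rewrite /cube_map /= mul1r divff// scale1r subrK.
Qed.

Lemma nested_cube1 k : nested_cube [:: k] = block_cube (d [::]) k.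
Proof.
rewrite /nested_cube /= /relativize_cube cube_map_unit /=.
by rewrite mul1r divff// mul1r.
Qed.

End Construction.

Arguments middle_square : clear implicits.
Arguments unit_cube : clear implicits.

(* Main.v *)
Require Import Defs.
From HB Require Import structures.
From mathcomp Require Import all_boot all_order all_algebra.
From mathcomp Require Import all_classical all_reals all_analysis.
From mathcomp Require Import zify ring lra.

Import Order.TTheory GRing.Theory Num.Theory.
Import numFieldNormedType.Exports.
Local Open Scope classical_set_scope.
Local Open Scope ring_scope.

Set Implicit Arguments.
Unset Strict Implicit.
Unset Printing Implicit Defensive.

(** Up to scale, the part of X inside any cube of the construction is X itself:
    with [phi k] the affine map of the unit cube onto the [k]-th cube of the
    block, X is the union of E and of the sets [phi k @` X]
    ([limit_set_refine]).  Horizontal slabs separate the cubes from each other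
    and from E, so [phi k @` X] is open in X ([phi_limit_set_open]), and it is
    closed by compactness.  A connected set with two points has no isolated
    point, so infinitely many [d k] lie near any given point of E
    ([dense_tail]), and with them arbitrarily small cubes.  By self-similarity
    every neighbourhood of every point x of X then contains an open copy of X
    that misses x ([limit_set_copies]).

    This property alone makes a compact metric space T h-homogeneous and
    non-reconstructible.  Applied repeatedly, it yields disjoint clopen copies
    of T converging to x ([null_sequence_of_copies]).  These copies form a
    locally finite family of open pieces in the complement of x, so they may be
    permuted at will, or made to absorb new pieces.

    - Given a clopen set U containing x, place a copy of the complement W of U
      in each of the copies of T that converge to x inside U.  Sending W to its
      first copy, each copy to the next, and fixing everything else is a
      homeomorphism from the complement of x in T onto the complement of x in U.
      By compactness it extends to x ([homeo_sets_add_point]), so U is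
      homeomorphic to T ([homeo_sets_clopen]).
    - Let Z be the product of T and the discrete space of natural numbers, that
      is, countably many disjoint copies of T.  Deleting a point of Z leaves T
      minus a point x together with countably many copies of T, and these are
      absorbed by the copies of T converging to x
      ([homeo_sets_punctured_layers]).  So Z has the same deck as T, but it is
      not compact. *)

(** * Homeomorphic open subsets *)

(** One half of a homeomorphism between [A] and [B] that is given by maps of the
    ambient spaces.  Continuity is asked at the points of [A] in the ambient
    topology, which amounts to continuity on the subspace [A] as long as [A] is
    open; working with open sets makes gluing a local matter. *)
Definition embeds_via (T S : topologicalType) (A : set T) (B : set S)
    (f : T -> S) (g : S -> T) : Prop :=
  forall x, A x -> [/\ B (f x), g (f x) = x & {for x, continuous f}].

Definition homeo_via (T S : topologicalType) (A : set T) (B : set S)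
    (f : T -> S) (g : S -> T) : Prop :=
  embeds_via A B f g /\ embeds_via B A g f.

Definition homeo_sets (T S : topologicalType) (A : set T) (B : set S) : Prop :=
  exists f g, homeo_via A B f g.

Lemma homeo_via_sym (T S : topologicalType) (A : set T) (B : set S) f g :
  homeo_via A B f g -> homeo_via B A g f.
Proof. by case. Qed.

Lemma homeo_via_id (T : topologicalType) (A : set T) : homeo_via A A id id.
Proof. by split=> x Ax; split=> //; exact: cvg_id. Qed.

Lemma embeds_via_comp (T S V : topologicalType) (A : set T)
    (B : set S) (C : set V) f g f' g' :
  embeds_via A B f g -> embeds_via B C f' g' ->
  embeds_via A C (f' \o f) (g \o g').
Proof.
move=> fg fg' x /fg[Bfx gfx cf]; have [Cfx gfx' cf'] := fg' _ Bfx.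
by split=> //=; [rewrite gfx' gfx | exact: continuous_comp].
Qed.

Lemma continuous_at_eq_near (T S : topologicalType) (f g : T -> S) (A : set T) x :
  open A -> A x -> {in A, f =1 g} -> {for x, continuous f} ->
  {for x, continuous g}.
Proof.
move=> oA Ax fg cf; rewrite /prop_for /continuous_at -fg ?inE//.
move=> O /cf fO; rewrite /nbhs/=.
have nA : nbhs x A by exact: open_nbhs_nbhs.
by apply: filterS2 nA fO => y Ay; rewrite /= fg ?inE.
Qed.

Lemma homeo_via_comp (T S V : topologicalType) (A : set T)
    (B : set S) (C : set V) f g f' g' :
  homeo_via A B f g -> homeo_via B C f' g' ->
  homeo_via A C (f' \o f) (g \o g').
Proof.
move=> [fg gf] [fg' gf']; split.
  exact: embeds_via_comp fg fg'.
exact: embeds_via_comp gf' gf.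
Qed.

Section Gluing.
Variables (T S : topologicalType) (I : Type).

(** [i0] supplies a value outside the union of the pieces. *)
Definition glue (A : I -> set T) (f : I -> T -> S) (i0 : I) (x : T) : S :=
  if pselect (exists i, A i x) is left e then f (projT1 (cid e)) x else f i0 x.

Lemma glueE (A : I -> set T) f i0 i x : trivIset setT A -> A i x ->
  glue A f i0 x = f i x.
Proof.
move=> tA Ax; rewrite /glue; case: pselect => [e|[]]; last by exists i.
by congr (f _ x); apply: tA => //; exists x; split=> //; exact: projT2 (cid e).
Qed.

End Gluing.

Lemma embeds_via_glue (T S : topologicalType) (I : Type) (A : I -> set T)
    (B : I -> set S) f g i0 :
    (forall i, open (A i)) -> trivIset setT A -> trivIset setT B ->
    (forall i, embeds_via (A i) (B i) (f i) (g i)) ->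
  embeds_via (\bigcup_i A i) (\bigcup_i B i) (glue A f i0) (glue B g i0).
Proof.
move=> oA tA tB fg x [i _ Ax]; have [Bfx gfx cf] := fg i x Ax; split.
- by exists i => //; rewrite (glueE _ _ tA Ax).
- by rewrite (glueE _ _ tA Ax) (glueE _ _ tB Bfx).
- apply: (continuous_at_eq_near (oA i) Ax) cf => y; rewrite inE => Ay.
  by rewrite (glueE _ _ tA Ay).
Qed.

(** Open pieces make continuity a property of each piece separately, so disjoint
    unions of homeomorphic open pieces are homeomorphic. *)
Lemma homeo_sets_glue (T S : topologicalType) (I : Type) (A : I -> set T)
    (B : I -> set S) (i0 : I) :
    (forall i, open (A i)) -> (forall i, open (B i)) ->
    trivIset setT A -> trivIset setT B ->
    (forall i, homeo_sets (A i) (B i)) ->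
  homeo_sets (\bigcup_i A i) (\bigcup_i B i).
Proof.
move=> oA oB tA tB AB; have [f fP] := choice AB; have [g fgP] := choice fP.
exists (glue A f i0), (glue B g i0).
by split; apply: embeds_via_glue => // i; have [] := fgP i.
Qed.


Lemma homeo_sets_sym (T S : topologicalType) (A : set T) (B : set S) :
  homeo_sets A B -> homeo_sets B A.
Proof. by move=> [f [g /homeo_via_sym fg]]; exists g, f. Qed.

Lemma homeo_sets_trans (T S V : topologicalType) (A : set T) (B : set S)
  (C : set V) : homeo_sets A B -> homeo_sets B C -> homeo_sets A C.
Proof.
move=> [f [g fg]] [f' [g' fg']]; exists (f' \o f), (g \o g').
exact: homeo_via_comp fg fg'.
Qed.

Lemma homeo_sets_refl (T : topologicalType) (A : set T) : homeo_sets A A.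
Proof. by exists id, id; exact: homeo_via_id. Qed.

Lemma homeomorphic_sym (T S : topologicalType) :
  homeomorphic T S -> homeomorphic S T.
Proof. by move=> [f [g [? ? ? ?]]]; exists g, f. Qed.

Lemma homeomorphic_trans (T S V : topologicalType) :
  homeomorphic T S -> homeomorphic S V -> homeomorphic T V.
Proof.
move=> [f [g [cf cg fg gf]]] [f' [g' [cf' cg' fg' gf']]].
exists (f' \o f), (g \o g'); split.
- by move=> x; apply: continuous_comp; [exact: cf | exact: cf'].
- by move=> x; apply: continuous_comp; [exact: cg' | exact: cg].
- exact: can_comp.
- exact: can_comp.
Qed.

Lemma set_val_continuous (T : topologicalType) (A : set T) :
  continuous (@set_val T A).
Proof. exact: initial_continuous. Qed.

Lemma embeds_via_lift (T S : topologicalType) (A : set T) (B : set S) f g :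
  embeds_via A B f g ->
  exists2 h : set_type A -> set_type B, continuous h &
    forall x, set_val (h x) = f (set_val x).
Proof.
move=> fg.
have Bf (x : set_type A) : B (f (set_val x)) by have [] := fg _ (set_valP x).
exists (fun x => SigSub (mem_set (Bf x))) => //.
apply: continuous_comp_initial => x /=.
have [_ _ cf] := fg _ (set_valP x).
by apply: (@continuous_comp _ _ _ set_val f) cf; exact: set_val_continuous.
Qed.

Lemma homeo_sets_homeomorphic (T S : topologicalType) (A : set T) (B : set S) :
  homeo_sets A B -> homeomorphic (set_type A) (set_type B).
Proof.
move=> [f [g [fg gf]]]; have [h ch hE] := embeds_via_lift fg.
have [k ck kE] := embeds_via_lift gf; exists h, k; split=> // x.
  by apply: val_inj; rewrite -!set_valE kE hE; have [] := fg _ (set_valP x).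
by apply: val_inj; rewrite -!set_valE hE kE; have [] := gf _ (set_valP x).
Qed.

Lemma homeomorphic_setT (T : topologicalType) :
  homeomorphic (set_type [set: T]) T.
Proof.
exists set_val, (fun x => SigSub (mem_set (I : [set: T] x))).
split=> //; first exact: set_val_continuous.
- by apply: continuous_comp_initial => x; exact: cvg_id.
- by move=> x; apply: val_inj.
Qed.

(** * Compactness *)

(** A neighbourhood [W] of [b] leaves out the compact part [K] of [B], whose
    preimage [g @` K] is compact, hence closed, and does not contain [a]; so the
    points near [a] are sent into [W]. *)
Lemma embeds_via_add_point (T S : topologicalType) (A : set T) (B : set S)
    a b f g :
    hausdorff_space T -> open A -> A a -> compact B -> B b ->
    homeo_via (A `\ a) (B `\ b) f g ->
  embeds_via A B (fun x => if x == a then b else f x)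
                 (fun y => if y == b then a else g y).
Proof.
move=> hT oA Aa cB Bb [fg gf] x Ax.
have oAa : open (A `\ a).
  rewrite setDE; apply: openI => //; apply: closed_openC.
  by apply: accessible_closed_set1; exact: hausdorff_accessible.
have [->|xa] := eqVneq x a.
  rewrite eqxx; split=> //.
  rewrite /prop_for /continuous_at eqxx => O; rewrite nbhsE => -[W [oW Wb] WO].
  pose K := B `&` ~` W.
  have KB : K `<=` B `\ b by move=> y [By nWy]; split=> // yb; apply: nWy; rewrite yb.
  have cK : compact K by apply: compact_closedI => //; exact: open_closedC.
  have cgK : closed (g @` K).
    apply: compact_closed => //; apply: continuous_compact => //.
    apply: continuous_in_subspaceT => y; rewrite inE => /KB Ky.
    by have [_ _] := gf _ Ky.
  have nK : nbhs a (~` (g @` K)).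
    apply: open_nbhs_nbhs; split; first exact: closed_openC.
    by move=> [y /KB/gf[[_ ga] _ _] /ga].
  rewrite /nbhs/=; have nA : nbhs a A by exact: open_nbhs_nbhs.
  apply: filterS2 nK nA => z nKz Az /=; case: eqVneq => [_|/eqP za].
    exact: WO.
  have [[Bfz fzb] gfz _] := fg z (conj Az za).
  apply: WO; apply: contrapT => nW; apply: nKz; exists (f z) => //.
have Aax : (A `\ a) x by split=> //; exact/eqP.
have [[Bfx /eqP fxb] gfx cf] := fg _ Aax; split; rewrite ?(negbTE xa)//.
  by rewrite (negbTE fxb).
apply: (continuous_at_eq_near oAa Aax) cf => y; rewrite inE => -[_ /eqP ya].
by rewrite (negbTE ya).
Qed.

(** A compact Hausdorff space is the one-point compactification of the
    complement of any of its points, and is therefore determined by it. *)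
Lemma homeo_sets_add_point (T S : topologicalType) (A : set T) (B : set S)
    a b :
    hausdorff_space T -> hausdorff_space S -> open A -> open B ->
    compact A -> compact B -> A a -> B b ->
  homeo_sets (A `\ a) (B `\ b) -> homeo_sets A B.
Proof.
move=> hT hS oA oB cA cB Aa Bb [f [g fg]].
exists (fun x => if x == a then b else f x), (fun y => if y == b then a else g y).
split; first exact: embeds_via_add_point fg.
by apply: embeds_via_add_point => //; exact: homeo_via_sym.
Qed.

(** The value outside the range of [p] is arbitrary; [y] avoids asking for a
    distinguished point of [T]. *)
Definition left_inverse_of (T : topologicalType) (p : T -> T) (y : T) : T :=
  if pselect (exists x, p x = y) is left e then projT1 (cid e) else y.

Lemma left_inverse_ofK (T : topologicalType) (p : T -> T) :
  injective p -> cancel p (left_inverse_of p).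
Proof.
move=> ip x; rewrite /left_inverse_of; case: pselect => [e|[]]; last by exists x.
by apply: ip; exact: projT2 (cid e).
Qed.

(** A continuous injection of a compact space into a Hausdorff space is a closed
    map, so its inverse is continuous on the range. *)
Lemma homeo_via_image (T : topologicalType) (p : T -> T) (W : set T) :
    hausdorff_space T -> compact [set: T] ->
    continuous p -> injective p -> open (range p) ->
  homeo_via W (p @` W) p (left_inverse_of p).
Proof.
move=> hT cT cp ip op; split=> [x Wx|_ [x Wx <-]].
  by split; [exists x | exact: left_inverse_ofK | exact: cp].
rewrite left_inverse_ofK//; split=> //.
rewrite /prop_for /continuous_at left_inverse_ofK// => O.
rewrite nbhsE => -[V [oV Vx] VO]; rewrite /nbhs/=.
have cK : closed (p @` (~` V)).
  apply: compact_closed => //; apply: continuous_compact.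
    exact: continuous_subspaceT.
  apply: subclosed_compact cT _ => //; exact: open_closedC.
have nK : nbhs (p x) (~` (p @` (~` V))).
  apply: open_nbhs_nbhs; split; first exact: closed_openC.
  by move=> [y nVy /ip yx]; apply: nVy; rewrite yx.
have nr : nbhs (p x) (range p) by apply: open_nbhs_nbhs; split=> //; exists x.
apply: filterS2 nK nr => z nKz [y _ yz]; rewrite /= -yz left_inverse_ofK//.
by apply: VO; apply: contrapT => nV; apply: nKz; exists y.
Qed.

Lemma compact_set_type (T : topologicalType) (A : set T) :
  compact A -> compact [set: set_type A].
Proof.
move=> cA F FF _.
have [|p [Ap clp]] := cA (set_val @ F).
  rewrite nbhs_simpl; apply: (@filterS _ F _ setT); last exact: filterT.
  by move=> x _; exact: set_valP.
exists (SigSub (mem_set Ap)); split=> // B O FB [_ [[V oV <-] Vp VO]].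
have [|_ [[x Bx <-] Vx]] := clp (set_val @` B) V _ (open_nbhs_nbhs (conj oV Vp)).
  apply: (@filterS _ F _ B) FB => x Bx; by exists x.
by exists x; split=> //; exact: VO.
Qed.

(** * Spaces with copies of themselves near every point *)

Definition copies_near_points (T : topologicalType) : Prop :=
  forall (x : T) O, nbhs x O -> exists p : T -> T,
    [/\ continuous p, injective p, open (range p) & range p `<=` O `\ x].

Section Copies.
Variables (R : realType) (T : pseudoMetricType R).
Hypotheses (hT : hausdorff_space T) (cT : compact [set: T]).

Lemma closed_image (p : T -> T) (W : set T) :
  continuous p -> closed W -> closed (p @` W).
Proof.
move=> cp cW; apply: compact_closed => //; apply: continuous_compact.
  exact: continuous_subspaceT.
exact: subclosed_compact cT _.
Qed.

(** The image of [W] is the range of [p] minus the image of the complement of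
    [W], which is closed. *)
Lemma clopen_image (p : T -> T) (W : set T) :
    continuous p -> injective p -> open (range p) -> clopen W ->
  clopen (p @` W).
Proof.
move=> cp ip op [oW cW]; split; last exact: closed_image.
have -> : p @` W = range p `&` ~` (p @` (~` W)).
  apply/seteqP; split=> [_ [y Wy <-]|_ [[y _ <-] nWy]].
    by split; [exists y | move=> [z nWz /ip zy]; apply: nWz; rewrite zy].
  by exists y => //; apply: contrapT => nW; apply: nWy; exists y.
by apply: openI => //; apply: closed_openC; apply: closed_image => //;
  exact: open_closedC.
Qed.

(** Closed sets that converge to [x] form a locally finite family away from
    [x]. *)
Lemma open_compl_null_sequence (x : T) (G : nat -> set T) :
    (forall n, closed (G n)) ->
    (forall V, nbhs x V -> exists N, forall n, (N <= n)%N -> G n `<=` V) ->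
  open (~` (x |` \bigcup_n G n)).
Proof.
move=> cG Gx; rewrite openE => y nxGy; rewrite /interior.
have yx : y != x by apply/eqP => yx; apply: nxGy; left.
move: (hT); rewrite open_hausdorff => /(_ _ _ yx)[[A B]/=].
rewrite !inE => -[Ay Bx] [oA oB AB0]; have AB : A `&` B = set0 by [].
have [N NG] := Gx B (open_nbhs_nbhs (conj oB Bx)).
pose K := \bigcup_(n in `I_N) G n.
have cK : closed K by apply: closed_bigcup.
have nK : nbhs y (~` K).
  apply: open_nbhs_nbhs; split; first exact: closed_openC.
  by move=> [n _ Gny]; apply: nxGy; right; exists n.
apply: filterS2 nK (open_nbhs_nbhs (conj oA Ay)) => z nKz Az.
have nBz : ~ B z by move=> Bz; have : set0 z by rewrite -AB.
move=> [zx|[n _ Gnz]]; first by apply: nBz; rewrite zx.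
have [nN|Nn] := ltnP n N; first by apply: nKz; exists n.
exact/nBz/(NG n).
Qed.

Hypothesis T_copies : copies_near_points T.

(** The copies are chosen one after the other.  A copy is closed by compactness
    and misses [x], so its complement is a neighbourhood of [x], in which the
    next copy can be taken; that copy is also taken in a smaller ball around
    [x]. *)
Lemma null_sequence_of_copies (x : T) (O : set T) : nbhs x O ->
  exists p : nat -> T -> T,
    [/\ forall n, continuous (p n) /\ injective (p n),
        forall n, open (range (p n)),
        trivIset setT (fun n => range (p n)),
        forall n, range (p n) `<=` O `\ x &
        forall V, nbhs x V ->
          exists N, forall n, (N <= n)%N -> range (p n) `<=` V].
Proof.
move=> nO.
have /choice[sel selP] : forall U : set T, exists p : T -> T, nbhs x U ->
    [/\ continuous p, injective p, open (range p) & range p `<=` U `\ x].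
  move=> U; have [nU|nU] := pselect (nbhs x U); last by exists id.
  by have [p pP] := T_copies nU; exists p.
pose ballx n : set T := ball x n.+1%:R^-1.
(* [U n] is where the copy number [n] is chosen. *)
pose fix U n := if n is m.+1 then
    U m `&` ~` range (sel (U m)) `&` ballx m.+1 else O `&` ballx 0.
have nball n : nbhs x (ballx n) by apply: nbhsx_ballx; rewrite invr_gt0.
have nU n : nbhs x (U n).
  elim: n => [|n IH] /=; first exact: filterI.
  apply: filterI => //; apply: filterI => //.
  have [cp _ _ pU] := selP _ IH.
  apply: open_nbhs_nbhs; split; first exact/closed_openC/closed_image/closedT.
  by move=> /pU[_ /(_ erefl)].
have Uball n : U n `<=` ballx n by case: n => [|n] y [].
have US m n : (m <= n)%N -> U n `<=` U m.
  move=> /subnK <-; elim: (n - m)%N => [|k IH]//.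
  by apply: subset_trans IH => y [[]].
have pU n : range (sel (U n)) `<=` U n.
  by have [_ _ _ pU] := selP _ (nU n); move=> y /pU[].
have disj m n : (m < n)%N -> range (sel (U m)) `&` range (sel (U n)) = set0.
  move=> mn; rewrite -subset0 => y [my /pU ny].
  by have [[_]] := US _ _ mn _ ny.
exists (fun n => sel (U n)); split.
- by move=> n; have [] := selP _ (nU n).
- by move=> n; have [] := selP _ (nU n).
- move=> m n _ _ [y]; case: (ltngtP m n) => // mn; first by rewrite disj.
  by rewrite setIC disj.
- move=> n y yU; split; first by have := US _ _ (leq0n n) _ (pU _ _ yU); case.
  by have [_ _ _ /(_ _ yU)[]] := selP _ (nU n).
- move=> V /nbhs_ballP[e/= e0 eV]; exists (Num.truncn e^-1) => n Nn.
  apply: subset_trans eV; apply: subset_trans (pU n) _.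
  apply: subset_trans (Uball n) _; apply: le_ball.
  rewrite -[leRHS]invrK lef_pV2 ?posrE ?invr_gt0//.
  apply/ltW; apply: lt_le_trans (truncnS_gt _) _.
  by rewrite ler_nat.
Qed.

(** Hilbert's hotel: in the complement of a point [x] of [U], the complement of
    [U] moves to the first of infinitely many copies of itself that converge to
    [x] inside [U], and each of these copies moves to the next. *)
Lemma homeo_sets_clopen (U : set T) : clopen U -> U !=set0 ->
  homeo_sets U [set: T].
Proof.
move=> [oU cU] [x Ux].
have [p [pci po pt pU pV]] := null_sequence_of_copies (open_nbhs_nbhs (conj oU Ux)).
have oW : open (~` U) by exact: closed_openC.
have clW : clopen (~` U) by split=> //; exact: open_closedC.
pose G n := p n @` (~` U).
have Gp n : G n `<=` range (p n) by move=> y [z _ <-]; exists z.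
have clG n : clopen (G n) by have [? ?] := pci n; exact: clopen_image.
pose C := U `&` ~` (x |` \bigcup_n G n).
have oC : open C.
  apply: openI => //; apply: open_compl_null_sequence => [n|V /pV[N NV]].
    by have [] := clG n.
  by exists N => n /NV; apply: subset_trans.
have GE m n y : G m y -> G n y -> m = n.
  by move=> /Gp my /Gp ny; apply: pt => //; exists y.
have GU n y : G n y -> U y by move=> /Gp/pU[].
have Gx n y : G n y -> y <> x by move=> /Gp/pU[].
apply: homeo_sets_sym.
apply: (@homeo_sets_add_point _ _ _ _ x x) => //; first exact: openT.
  exact: subclosed_compact cT _.
(* [C] stays in place; index [Some j] sends [A (Some j)] to the copy [G j]. *)
pose A i := if i is Some j then if j is n.+1 then G n else ~` U else C.
pose B i := if i is Some n then G n else C.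
have -> : [set: T] `\ x = \bigcup_i A i.
  apply/seteqP; split=> y; last first.
    case=> -[[|n]|] _ /=.
    - by move=> nUy; split=> // yx; apply: nUy; rewrite yx.
    - by move/Gx.
    - by move=> [_ nC]; split=> // yx; apply: nC; left.
  move=> [_ yx]; have [Uy|nUy] := pselect (U y); last by exists (Some 0%N).
  have [[n _ Gy]|nGy] := pselect ((\bigcup_n G n) y); first by exists (Some n.+1).
  by exists None => //; split=> // -[].
have -> : U `\ x = \bigcup_i B i.
  apply/seteqP; split=> y; last first.
    case=> -[n|] _ /=; first by move=> Gy; split; [exact: GU Gy | exact: Gx Gy].
    by move=> [Uy nC]; split=> // yx; apply: nC; left.
  move=> [Uy yx].
  have [[n _ Gy]|nGy] := pselect ((\bigcup_n G n) y); first by exists (Some n).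
  by exists None => //; split=> // -[].
have CG n y : C y -> G n y -> False.
  by move=> [_ nC] Gy; apply: nC; right; exists n.
apply: (homeo_sets_glue None).
- by case=> [[|n]|] //=; have [] := clG n.
- by case=> [n|] //=; have [] := clG n.
- move=> [[|m]|] [[|n]|] _ _ [y []] //=.
  + by move=> nUy /GU.
  + by move=> nUy [].
  + by move=> /GU.
  + by move=> /GE /[apply] ->.
  + by move=> /[swap] /CG /[apply].
  + by move=> [].
  + by move=> /CG /[apply].
- move=> [m|] [n|] _ _ [y []] //=.
  + by move=> /GE /[apply] ->.
  + by move=> /[swap] /CG /[apply].
  + by move=> /CG /[apply].
have WG n : homeo_sets (~` U) (G n).
  by have [? ?] := pci n; exists (p n), (left_inverse_of (p n)); exact: homeo_via_image.
case=> [[|n]|] /=; [exact: WG | | exact: homeo_sets_refl].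
by apply: homeo_sets_trans (WG n.+1); apply: homeo_sets_sym.
Qed.

Theorem h_homogeneous_copies : h_homogeneous T.
Proof.
move=> U U0 clU; apply: homeomorphic_trans (homeomorphic_setT T).
by apply: homeo_sets_homeomorphic; exact: homeo_sets_clopen.
Qed.

(** [layer n A] is the copy of [A] in the [n]-th summand of [T * nat], the
    disjoint union of countably many copies of [T]. *)
Let layer (n : nat) (A : set T) : set (T * nat) := [set z | A z.1 /\ z.2 = n].

Lemma open_layer n A : open A -> open (layer n A).
Proof.
move=> oA; have -> : layer n A = (fst @^-1` A) `&` (snd @^-1` [set n]).
  by apply/seteqP; split=> -[].
apply: openI; apply: open_comp => //.
- by move=> z _; exact: cvg_fst.
- by move=> z _; exact: cvg_snd.
- exact: discrete_open.
Qed.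

Lemma homeo_sets_layer n A : homeo_sets (layer n A) A.
Proof.
exists fst, (fun y => (y, n)); split=> [[y m] /= [Ay /= ->]|y Ay]; split=> //.
- exact: cvg_fst.
- apply: (@cvg_pair _ _ _ (nbhs y) (nbhs y) (nbhs n)); first exact: cvg_id.
  exact: cvg_cst.
Qed.

(** In the complement of [x], the copies of [T] that converge to [x] are as many
    as these copies together with the other summands: the former are sent to the
    copies of even index, the summand [bump k i], with [i] any natural number,
    to the copy of index [2 * i + 1]. *)
Lemma homeo_sets_punctured_layers (x : T) (k : nat) :
  homeo_sets [set~ (x, k)] [set~ x].
Proof.
have [p [pci po pt pU pV]] := null_sequence_of_copies (@filterT _ (nbhs x) _).
pose G n := range (p n).
have clG n : clopen (G n).
  by have [? ?] := pci n; apply: clopen_image => //; exact: clopenT.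
pose C := ~` (x |` \bigcup_n G n).
have oC : open C.
  by apply: open_compl_null_sequence => // n; have [] := clG n.
have GE m n y : G m y -> G n y -> m = n.
  by move=> my ny; apply: pt => //; exists y.
have Gx n y : G n y -> y <> x by move=> /pU[].
have CG n y : C y -> G n y -> False.
  by move=> nC Gy; apply: nC; right; exists n.
pose A (i : option (bool * nat)) : set (T * nat) :=
  match i with
  | None => layer k C
  | Some (false, m) => layer k (G m)
  | Some (true, m) => layer (bump k m) setT
  end.
pose B (i : option (bool * nat)) : set T :=
  if i is Some (b, m) then G (m.*2 + b)%N else C.
have -> : [set~ (x, k)] = \bigcup_i A i.
  apply/seteqP; split=> -[y m] /=; last first.
    case=> -[[[] n]|] _ /= [] Gy /=.
    + move=> -> [_ nk]; by move: (neq_bump k n); rewrite nk eqxx.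
    + by move=> _ [yx _]; exact: Gx Gy yx.
    + by move=> _ [yx _]; apply: Gy; left.
  have [->|mk] := eqVneq m k; last first.
    by move=> _; exists (Some (true, unbump k m)) => //; split=> //=; rewrite unbumpK.
  move=> yx; have {}yx : y <> x by move=> e; apply: yx; rewrite e.
  have [[n _ Gy]|nGy] := pselect ((\bigcup_n G n) y).
    by exists (Some (false, n)).
  by exists None => //; split=> // -[].
have -> : [set~ x] = \bigcup_i B i.
  apply/seteqP; split=> y /=; last first.
    case=> -[[b n]|] _ /=; first exact: Gx.
    by move=> nC yx; apply: nC; left.
  move=> yx.
  have [[n _ Gy]|nGy] := pselect ((\bigcup_n G n) y).
    exists (Some (odd n, n./2)) => //=.
    by rewrite addnC odd_double_half.
  by exists None => // -[].
apply: (homeo_sets_glue None).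
- case=> [[[] n]|] /=; apply: open_layer => //; first exact: openT.
  by have [] := clG n.
- by case=> [[b n]|] //=; have [] := clG (n.*2 + b)%N.
- move=> [[[] m]|] [[[] n]|] _ _ [[y j] /= [[/= Cy jm] [/= Cy' jn]]] //.
  + by have /(can_inj (bumpK k)) -> : bump k m = bump k n by exact: etrans (esym jm) jn.
  + by have := neq_bump k m; rewrite -jm -jn eqxx.
  + by have := neq_bump k m; rewrite -jm -jn eqxx.
  + by have := neq_bump k n; rewrite -jn -jm eqxx.
  + by rewrite (GE _ _ _ Cy Cy').
  + by case: (CG _ _ Cy' Cy).
  + by have := neq_bump k n; rewrite -jn -jm eqxx.
  + by case: (CG _ _ Cy Cy').
- move=> [[b m]|] [[c n]|] _ _ [y [/= Gy Gy']] //.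
  + have e := GE _ _ _ Gy Gy'.
    have bc : b = c by move: (congr1 odd e); rewrite !oddD !odd_double !oddb.
    by move: e; rewrite bc => /addIn/double_inj ->.
  + by case: (CG _ _ Gy' Gy).
  + by case: (CG _ _ Gy Gy').
have TG n : homeo_sets [set: T] (G n).
  by have [? ?] := pci n; exists (p n), (left_inverse_of (p n)); exact: homeo_via_image.
case=> [[[] n]|] /=; apply: homeo_sets_trans (homeo_sets_layer _ _) _.
- exact: TG.
- by apply: homeo_sets_trans (TG _); apply: homeo_sets_sym; exact: TG.
- exact: homeo_sets_refl.
Qed.

Lemma homeo_class_eq (X Y : topologicalType) :
  homeomorphic X Y -> homeo_class X = homeo_class Y.
Proof.
move=> XY; apply: funext => Z; apply: propext; split.
  by apply: homeomorphic_trans; exact: homeomorphic_sym.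
exact: homeomorphic_trans.
Qed.

Lemma layers_not_compact (x : T) : ~ compact [set: T * nat].
Proof.
move=> cTn; have : compact [set: nat].
  have -> : [set: nat] = snd @` [set: T * nat].
    by apply/seteqP; split=> // n _; exists (x, n).
  apply: continuous_compact => //; apply: continuous_subspaceT => z.
  exact: cvg_snd.
rewrite compact_cover => /(_ nat setT (fun n => [set n])).
case=> [n _|n _|D _ cov]; [exact: discrete_open | by exists n |].
apply: infinite_nat; apply: sub_finite_set (finite_fset D) => n _.
by have [m mD ->] := cov n I.
Qed.

(** The countable disjoint union of copies of [T] has the deck of [T], and it is
    not compact. *)
Theorem not_reconstructible_copies : [set: T] !=set0 -> ~ reconstructible T.
Proof.
move=> [x _] /(_ (T * nat)%type)[].
  apply: funext => K; apply: propext; split=> [[[y n] ->]|[y ->]].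
    exists y; apply: homeo_class_eq.
    exact/homeo_sets_homeomorphic/homeo_sets_punctured_layers.
  exists (y, 0%N); apply/esym/homeo_class_eq.
  exact/homeo_sets_homeomorphic/homeo_sets_punctured_layers.
move=> f [g [cf cg fg gf]]; apply: (layers_not_compact x).
have -> : [set: T * nat] = g @` [set: T].
  by apply/seteqP; split=> // z _; exists (f z).
by apply: continuous_compact => //; exact: continuous_subspaceT.
Qed.

End Copies.

(** * Metric on subspaces of normed spaces *)

Section SubspaceMetric.
Variables (R : realType) (V : normedModType R) (A : set V).

Let dist (x y : set_type A) : R := `|set_val x - set_val y|.

Let dist_ge0 x y : 0 <= dist x y. Proof. exact: normr_ge0. Qed.

Let dist_positivity x y : dist x y = 0 -> x = y.
Proof. by move=> /normr0_eq0/subr0_eq/val_inj. Qed.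

Let ball_dist x e : ball x e = [set y | dist x y < e].
Proof.
by apply/seteqP; split=> y; rewrite /ball/= /initial_ball -ball_normE.
Qed.

HB.instance Definition _ := PseudoMetric_isMetric.Build R (set_type A)
  dist_ge0 dist_positivity ball_dist.

Lemma set_type_metrizable : metrizable R (set_type A).
Proof. by exists (set_type A); exists id, id; split=> // x; exact: cvg_id. Qed.

End SubspaceMetric.

Lemma affine_continuous (R : realType) (V : normedModType R) (a : R) (b c : V) :
  continuous (fun x => a *: (x - b) + c).
Proof.
move=> x; apply: cvgD; last exact: cvg_cst.
by apply: cvgZ; [exact: cvg_cst | apply: cvgB; [exact: cvg_id | exact: cvg_cst]].
Qed.

(** * Coordinates *)

Section Coordinates.
Variables (R : realType) (n : nat).
Implicit Types x : 'rV[R]_n.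

Lemma coord_le_norm x i : `|x 0 i| <= `|x|.
Proof.
rewrite [leRHS]/Num.norm/= mx_normrE.
exact: (le_bigmax _ (fun ij : 'I_1 * 'I_n => `|x ij.1 ij.2|) (0, i)).
Qed.

Lemma norm_le_coord x r : 0 <= r -> (forall i, `|x 0 i| <= r) -> `|x| <= r.
Proof.
move=> r0 xr; rewrite [leLHS]/Num.norm/= mx_normrE; apply/bigmax_leP.
by split=> // -[i j] _; rewrite /= ord1.
Qed.

End Coordinates.

(** * The self-similar set *)

Section Geometry.
Variables (R : realType) (E : set 'rV[R]_3) (d : nat -> 'rV[R]_3).
Hypotheses (E_planar : E `<=` middle_square R) (d_in_E : range d `<=` E).
Local Notation pt := 'rV[R]_3.
Local Notation mid := (vec3 (1 / 2) (1 / 2) (1 / 2) : pt).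
Local Notation I3 := (cube_set (unit_cube R)).

(** The scale of the [k]-th cube of a block relative to the unit cube, which is
    also the height of its centre above the plane of E. *)
Definition ratio (k : nat) : R := 2 ^- (2 * k.+1).

Lemma ratio_gt0 k : 0 < ratio k.
Proof. by rewrite invr_gt0 exprn_gt0. Qed.

Lemma ratioS k : ratio k.+1 = ratio k / 4.
Proof.
rewrite /ratio mulnS exprD invfM mulrC; congr (_ * _^-1).
by rewrite expr2 -natrM.
Qed.

Lemma ratio_le j k : (j <= k)%N -> ratio k <= ratio j.
Proof.
move=> /subnK <-; elim: (k - j)%N => [|m IH]//; rewrite addSn ratioS.
by have := ratio_gt0 (m + j); lra.
Qed.

Lemma ratio_lt j k : (j < k)%N -> ratio k <= ratio j / 4.
Proof. by rewrite -ratioS; exact: ratio_le. Qed.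

Lemma ratio_le4 k : ratio k <= 1 / 4.
Proof.
apply: le_trans (ratio_le (leq0n k)) _.
by rewrite /ratio muln1 expr2 -natrM div1r.
Qed.

Lemma ratio_small (e : R) : 0 < e ->
  exists N, forall k, (N <= k)%N -> ratio k < e.
Proof.
move=> e0; exists (Num.truncn e^-1) => k Nk.
rewrite -[ltRHS]invrK ltf_pV2 ?posrE ?invr_gt0 ?exprn_gt0//.
apply: lt_le_trans (truncnS_gt _) _; rewrite -natrX ler_nat.
by apply: leq_trans (ltnW (ltn_expl _ (leqnn 2))); 
  rewrite mul2n -addnn; apply: leq_trans (leq_addr _ _); rewrite ltnS.
Qed.

Local Notation phi k := (cube_map (block_cube d k)).

(** Measured from the plane that contains E. *)
Definition height (x : pt) : R := x 0 ord_max - 1 / 2.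

Lemma height_lipschitz x y : `|height x - height y| <= `|x - y|.
Proof.
have -> : height x - height y = (x - y) 0 ord_max.
  by rewrite /height !mxE; ring.
exact: coord_le_norm.
Qed.

Lemma phiE k x : phi k x = ratio k *: (x - mid) + (d k + vec3 0 0 (ratio k)).
Proof.
rewrite /cube_map /=; congr (_ *: _ + _).
by rewrite exprD expr1 invfM mulrCA mulfV ?mulr1.
Qed.

Lemma phiB k x y : phi k x - phi k y = ratio k *: (x - y).
Proof. by rewrite !phiE opprD addrACA subrr addr0 -scalerBr opprB addrA subrK. Qed.

Lemma d_E k : E (d k). Proof. by apply: d_in_E; exists k. Qed.

Lemma height_E x : E x -> height x = 0.
Proof.
by move=> /E_planar[a _ [b _ <-]]; rewrite /height mxE /= subrr.
Qed.

Lemma height_phi k x : height (phi k x) = ratio k * (height x + 1).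
Proof.
have := height_E (d_E k); rewrite /height phiE !mxE/=; lra.
Qed.

Lemma unit_cubeP x : I3 x <-> forall i, `|x 0 i - 1 / 2| <= 1 / 2.
Proof.
have midE i : mid 0 i = 1 / 2 by rewrite mxE; case: i => [[|[|[|]]]].
have xmid i : (x - mid) 0 i = x 0 i - 1 / 2 by rewrite mxE [X in _ + X]mxE midE.
split=> [xI i|xI]; first by apply: le_trans xI; rewrite -xmid coord_le_norm.
by apply: norm_le_coord => [|i]; [rewrite /=; lra | rewrite xmid].
Qed.

Lemma E_unit_cube : E `<=` I3.
Proof.
move=> x /E_planar[a]; rewrite /= in_itv/= => /andP[a1 a2].
move=> [b]; rewrite /= in_itv/= => /andP[b1 b2] <-; apply/unit_cubeP => i.
by rewrite mxE ler_norml; case: i => [[|[|[|]]]]//= _; lra.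
Qed.

Lemma height_unit_cube x : I3 x -> -(1 / 2) <= height x <= 1 / 2.
Proof. by move=> /unit_cubeP/(_ ord_max); rewrite ler_norml. Qed.

Lemma height_phi_bounds k x : I3 x ->
  ratio k / 2 <= height (phi k x) <= 3 / 2 * ratio k.
Proof.
move=> /height_unit_cube/andP[h1 h2]; rewrite height_phi.
have := ratio_gt0 k; nra.
Qed.

Lemma phi_unit_cube k x : I3 x -> I3 (phi k x).
Proof.
move=> /unit_cubeP xI; apply/unit_cubeP => i.
have := xI i; rewrite phiE !mxE !ler_norml.
have [a + [b + dE]] := E_planar (d_E k); rewrite /= !in_itv/=.
move=> /andP[a1 a2] /andP[b1 b2].
have r0 := ratio_gt0 k; have r4 := ratio_le4 k.
rewrite -dE !mxE; case: i => [[|[|[|]]]]//= i3 /andP[x1 x2]; nra.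
Qed.

Lemma phi_near k x : I3 x -> `|phi k x - d k| <= 3 / 2 * ratio k.
Proof.
move=> xI; have r0 := ratio_gt0 k.
have -> : phi k x - d k = ratio k *: (x - mid) + vec3 0 0 (ratio k).
  by rewrite phiE addrA addrAC addrK.
apply: le_trans (ler_normD _ _) _.
have v : `|vec3 0 0 (ratio k)| <= ratio k.
  apply: norm_le_coord => [|i]; first exact: ltW.
  by rewrite mxE; case: i => [[|[|[|]]]]//= _; rewrite ?normr0 ?(ltW r0)// gtr0_norm.
have : `|ratio k *: (x - mid)| <= ratio k * (1 / 2).
  by rewrite normrZ gtr0_norm// ler_pM2l.
lra.
Qed.

Lemma phi_inj k : injective (phi k).
Proof.
move=> x y /eqP; rewrite -subr_eq0 phiB scaler_eq0 gt_eqF ?ratio_gt0//=.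
by rewrite subr_eq0 => /eqP.
Qed.

(** The ratios decrease by a factor of 4, while the heights in a cube vary by a
    factor of 3. *)
Lemma phi_disjoint j k x y : I3 x -> I3 y -> phi j x = phi k y -> j = k.
Proof.
wlog jk : j k x y / (j < k)%N.
  move=> H xI yI xy; case: (ltngtP j k) => // jk; first exact: H xy.
  exact/esym/(H _ _ y x).
move=> xI yI xy; have := height_phi_bounds j xI; rewrite xy.
have := height_phi_bounds k yI; have := ratio_lt jk; have := ratio_gt0 j.
move=> r0 rk hk hj; suff : ratio j < ratio j by rewrite ltxx.
lra.
Qed.

Lemma phi_not_E k x : I3 x -> ~ E (phi k x).
Proof.
move=> xI /height_E h0; have := height_phi_bounds k xI; rewrite h0 => hk.
have r0 := ratio_gt0 k; suff : ratio k < ratio k by rewrite ltxx.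
lra.
Qed.

Lemma phi_continuous k : continuous (phi k).
Proof. exact: affine_continuous. Qed.

(** An explicit inverse on the whole space shows that [phi k] is both an open and
    a closed map. *)
Definition phi_inv k (y : pt) : pt :=
  (ratio k)^-1 *: (y - (d k + vec3 0 0 (ratio k))) + mid.

Lemma phi_invK k : cancel (phi_inv k) (phi k).
Proof.
move=> y; rewrite phiE /phi_inv addrK scalerA mulfV ?gt_eqF ?ratio_gt0//.
by rewrite scale1r subrK.
Qed.

Lemma phiK k : cancel (phi k) (phi_inv k).
Proof. by move=> x; apply: (@phi_inj k); rewrite phi_invK. Qed.

Lemma phi_imageE k (A : set pt) : phi k @` A = phi_inv k @^-1` A.
Proof.
apply/seteqP; split=> [_ [x Ax <-]|y Ay] /=; first by rewrite phiK.
by exists (phi_inv k y) => //; rewrite phi_invK.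
Qed.

Lemma phi_closed k (A : set pt) : closed A -> closed (phi k @` A).
Proof.
by move=> cA; rewrite phi_imageE; apply: closed_comp => // x _; exact: affine_continuous.
Qed.

Lemma phi_open k (A : set pt) : open A -> open (phi k @` A).
Proof.
by move=> oA; rewrite phi_imageE; apply: open_comp => // x _; exact: affine_continuous.
Qed.

(** * Self-similarity of the limit *)

(** One step of the construction from the outside in.  The recursive definition
    works from the inside out, replacing the smallest cubes; as the list of
    continua is constant, both give the same stages. *)
Definition refine (A : set pt) : set pt := E `|` \bigcup_k phi k @` A.

Fixpoint word (f : seq nat) (x : pt) : pt :=
  if f is k :: f' then phi k (word f' x) else x.

Lemma word_rcons f k x : word (rcons f k) x = word f (phi k x).
Proof. by elim: f => //= j f ->. Qed.

Lemma word_unit_cube f x : I3 x -> I3 (word f x).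
Proof. by move=> xI; elim: f => //= k f; exact: phi_unit_cube. Qed.

Lemma cube_map_relativize (P Q : cube R) x :
  cube_map (relativize_cube P Q) x = cube_map Q (cube_map P x).
Proof.
rewrite /cube_map /= addrA; congr (_ + _).
rewrite -[in RHS]addrA [in RHS]scalerDr scalerA; congr (_ *: _ + _).
by rewrite mulrCA !mulrA.
Qed.

Lemma cube_map_nested f x : cube_map (nested_cube (fun=> d) f) x = word f x.
Proof.
rewrite /nested_cube -{2}(revK f); elim: (rev f) x => [|k r IH] x /=.
  exact: cube_map_unit.
by rewrite cube_map_relativize IH rev_cons word_rcons.
Qed.

Lemma relativize_unit_cube (Q : cube R) : relativize_cube (unit_cube R) Q = Q.
Proof.
case: Q => c r; rewrite /relativize_cube /cube_map /= subrr scaler0 add0r.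
by congr Cube; rewrite mulrAC div1r mulfV ?mul1r.
Qed.

Lemma cube_set_image (Q : cube R) : 0 < Defs.radius Q ->
  cube_set Q = cube_map Q @` I3.
Proof. by move=> Q0; rewrite -{1}(relativize_unit_cube Q) cube_set_relativize. Qed.

Lemma radius_block_cube k : 0 < Defs.radius (block_cube d k).
Proof. by rewrite /= invr_gt0 exprn_gt0. Qed.

Lemma radius_nested_cube f : 0 < Defs.radius (nested_cube (fun=> d) f).
Proof.
rewrite /nested_cube; elim: (rev f) => [|k r IH] /=; first by rewrite div1r invr_gt0.
by rewrite !mulr_gt0 // invr_gt0 exprn_gt0.
Qed.

Lemma cube_set_nested f : cube_set (nested_cube (fun=> d) f) = word f @` I3.
Proof.
rewrite cube_set_image ?radius_nested_cube//.
by apply: eq_imagel => x _; exact: cube_map_nested.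
Qed.

Lemma relativize_nested (A : set pt) f :
  relativize A (nested_cube (fun=> d) f) = word f @` A.
Proof. by apply: eq_imagel => x _; exact: cube_map_nested. Qed.

Lemma block_refine : block E d = refine I3.
Proof.
congr (_ `|` _); apply: eq_bigcupr => k _.
by rewrite cube_set_image // radius_block_cube.
Qed.

Lemma refine_unit_cube (A : set pt) : A `<=` I3 -> refine A `<=` I3.
Proof.
move=> AI x [/E_unit_cube//|[k _ [y /AI yI <-]]].
exact: phi_unit_cube.
Qed.

(** The recursive step of the construction, with cubes written as the images of
    the unit cube by words. *)
Definition replace_cubes (n : nat) (A : set pt) : set pt :=
  (A `\` \bigcup_(f in [set f : seq nat | size f = n]) (word f @` I3))
  `|` \bigcup_(f in [set f : seq nat | size f = n]) (word f @` refine I3).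

(** Refining inside the cubes of depth [n] and then placing a copy of the result
    in every first cube refines inside the cubes of depth [n.+1], since the
    first letter of a word is determined by the position of its cube. *)
Lemma refine_replace_cubes n (A : set pt) : A `<=` I3 ->
  refine (replace_cubes n A) = replace_cubes n.+1 (refine A).
Proof.
move=> AI; apply/seteqP; split=> y.
- move=> [Ey|[k _ [a [[Aa nfa]|[f fn [c Cc <-]]] <-]]].
  + left; split; first by left.
    move=> [[|k f]//= _ [x xI xy]]; move: Ey; rewrite -xy.
    by apply: phi_not_E; exact: word_unit_cube.
  + left; split; first by right; exists k => //; exists a.
    move=> [[|j f]//= [fn] [x xI xy]]; apply: nfa; exists f => //; exists x => //.
    have jk := phi_disjoint (word_unit_cube f xI) (AI _ Aa) xy.
    by rewrite jk in xy; exact: phi_inj xy.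
  + by right; exists (k :: f); [rewrite /= fn | exists c].
- move=> [[[Ey|[k _ [a Aa <-]]] nfy]|[[|k f]//= [fn] [c Cc <-]]].
  + by left.
  + right; exists k => //; exists a => //; left; split=> // -[f fn [x xI xa]].
    by apply: nfy; exists (k :: f); [rewrite /= fn | exists x => //=; rewrite xa].
  + by right; exists k => //; exists (word f c) => //; right; exists f.
Qed.

Lemma iter_refine_unit_cube n : iter n refine I3 `<=` I3.
Proof. by elim: n => //= n; exact: refine_unit_cube. Qed.

Lemma replace_cubes_iter n :
  replace_cubes n (iter n refine I3) = iter n.+1 refine I3.
Proof.
elim: n => [|n IH]; last first.
  by rewrite [in LHS]iterS -refine_replace_cubes ?IH//; exact: iter_refine_unit_cube.
apply/seteqP; split=> /= y.
  move=> [[yI nI]|[f /size0nil -> [c ? <-]]]//.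
  by exfalso; apply: nI; exists [::] => //; exists y.
by move=> Cy; right; exists [::] => //; exists y.
Qed.

Lemma stage_iter n : stage (fun=> E) (fun=> d) n = iter n.+1 refine I3.
Proof.
elim: n => [|n IH]; first exact: block_refine.
rewrite -replace_cubes_iter -IH; congr ((_ `\` _) `|` _); apply: eq_bigcupr => f _.
  exact: cube_set_nested.
by rewrite relativize_nested block_refine.
Qed.

Notation X := (limit_set (fun=> E) (fun=> d)).

Lemma limit_set_unit_cube : X `<=` I3.
Proof.
by move=> x /(_ 0%N I); rewrite stage_iter; apply: (@iter_refine_unit_cube 1%N).
Qed.

Lemma limit_setP x : X x <-> forall n, iter n.+1 refine I3 x.
Proof.
split=> [Xx n|Xx n _]; first by rewrite -stage_iter; exact: Xx.
by rewrite stage_iter.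
Qed.

(** The first letter of the address of a point does not depend on the stage. *)
Lemma limit_set_refine : X = refine X.
Proof.
apply/seteqP; split=> x.
- move=> /limit_setP Xx; have [Ex|[k _ [y yI xy]]] := Xx 0%N; first by left.
  right; exists k => //; exists y => //; apply/limit_setP => n.
  have [Ex|[j _ [z zn zx]]] := Xx n.+1.
    by rewrite -xy in Ex; case: (phi_not_E yI Ex).
  have zI := @iter_refine_unit_cube n.+1 _ zn.
  have jk : j = k by apply: (phi_disjoint zI yI); rewrite zx xy.
  by move: zx; rewrite jk -xy => /phi_inj <-.
- move=> Cx; apply/limit_setP => n; rewrite iterS.
  have {Cx}[Ex|[k _ [y Xy <-]]] := Cx; first by left.
  right; exists k => //; exists y => //.
  by case: n => [|n]; [exact: limit_set_unit_cube | exact: (limit_setP y).1 Xy n].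
Qed.

Lemma phi_limit_set k x : X x -> X (phi k x).
Proof. by move=> Xx; rewrite limit_set_refine; right; exists k => //; exists x. Qed.

Lemma E_limit_set : E `<=` X.
Proof. by move=> x Ex; rewrite limit_set_refine; left. Qed.

Lemma height_continuous : continuous height.
Proof.
move=> x; rewrite /continuous_at /height.
apply: (@cvgB _ _ _ (nbhs x)); last exact: cvg_cst.
exact: (@coord_continuous R 1 3 0 ord_max).
Qed.

(** The heights in the cube [k] lie between 1/2 and 3/2 times [ratio k], those in
    the later cubes are at most 3/8 times [ratio k], and those in the earlier
    cubes at least 2 times [ratio k]. *)
Lemma phi_limit_set_open k :
  exists2 G, open G & phi k @` X = X `&` G.
Proof.
exists (height @^-1` `]3 / 8 * ratio k, 2 * ratio k[%classic).
  apply: open_comp; last exact: interval_open.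
  by move=> x _; exact: height_continuous.
apply/seteqP; split=> [_ [x Xx <-]|y [Xy /= yk]].
  split; first exact: phi_limit_set.
  have := height_phi_bounds k (limit_set_unit_cube Xx).
  by have := ratio_gt0 k; rewrite /= in_itv/=; lra.
move: yk; rewrite in_itv/= => yk; have r0 := ratio_gt0 k.
move: Xy; rewrite {1}limit_set_refine => -[/height_E h0|[j _ [x Xx xy]]].
  suff : ratio k < ratio k by rewrite ltxx.
  by move: yk; rewrite h0; lra.
have := height_phi_bounds j (limit_set_unit_cube Xx); rewrite xy => hj.
case: (ltngtP j k) => [/ratio_lt jk|/ratio_lt kj|jk]; last by rewrite -jk; exists x.
  by suff : ratio k < ratio k; [rewrite ltxx | lra].
by suff : ratio k < ratio k; [rewrite ltxx | lra].
Qed.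

Section Closed.
Hypothesis E_closed : closed E.

(** Above the plane of E the cubes are locally finite.  A point of the cube [k]
    is within three times its height of [d k], so points of the cubes that
    approach the plane approach E. *)
Lemma closed_refine (A : set pt) : A `<=` I3 -> closed A -> closed (refine A).
Proof.
move=> AI cA y cly; have [hy|hy] := lerP (height y) 0.
  left; apply: E_closed => B /nbhs_ballP[e/= e0 eB].
  have e40 : 0 < e / 4 by lra.
  have [p [Ap]] := cly _ (nbhsx_ballx y _ e40).
  rewrite -ball_normE/= => yp.
  case: Ap yp => [Ep yp|[k _ [a /AI aI <-]] yp].
    by exists p; split=> //; apply: eB; rewrite -ball_normE/=; lra.
  exists (d k); split; first exact: d_E.
  apply: eB; rewrite -ball_normE/=.
  have := ler_distD (phi k a) y (d k).
  have := phi_near k aI; have := height_phi_bounds k aI.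
  have := height_lipschitz y (phi k a); rewrite ler_norml; lra.
have h4 : 0 < height y / 4 by lra.
have [N NP] := ratio_small h4.
have cK : closed (\bigcup_(k in `I_N) (phi k @` A)).
  by apply: closed_bigcup => // k _; exact: phi_closed.
suff : (\bigcup_(k in `I_N) (phi k @` A)) y.
  by move=> [k _ Ay]; right; exists k.
apply: contrapT => nKy; have h2 : 0 < height y / 2 by lra.
have nK : nbhs y (~` (\bigcup_(k in `I_N) (phi k @` A))).
  by apply: open_nbhs_nbhs; split=> //; exact: closed_openC.
have [p [Ap [nKp]]] := cly _ (filterI nK (nbhsx_ballx y _ h2)).
rewrite -ball_normE/= => yp.
suff : height y < height y by rewrite ltxx.
have := height_lipschitz y p; rewrite ler_norml.
case: Ap => [/height_E ->|[k _ [a Aa ap]]]; first lra.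
have := height_phi_bounds k (AI _ Aa); rewrite ap.
have [kN|/NP] := ltnP k N; first by case: nKp; exists k => //; exists a.
lra.
Qed.

Lemma limit_set_compact : compact X.
Proof.
apply: bounded_closed_compact.
  exists 1; split; first by rewrite num_real.
  move=> M M1 x /limit_set_unit_cube xI.
  apply: le_trans (ltW M1); apply: norm_le_coord => // i.
  move/unit_cubeP: xI => /(_ i); rewrite !ler_norml; lra.
apply: closed_bigI => n _; rewrite stage_iter.
have cI : closed I3.
  rewrite (_ : I3 = closed_ball_ Num.norm mid (1 / 2)).
    exact: closed_closed_ball_.
  by apply/seteqP; split=> x; rewrite /closed_ball_/cube_set/= distrC.
elim: n.+1 => //= m; apply: closed_refine; exact: iter_refine_unit_cube.
Qed.

End Closed.

Section Dense.
Hypotheses (E_connected : connected [set: set_type E])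
  (E_nontrivial : nontrivial_space (set_type E))
  (d_dense : E `<=` closure (range d)).

(** If only finitely many [d k] were near [x], their density would make E finite
    near [x], so that [x] would be isolated in E; but a connected Hausdorff space
    with two points has no isolated point. *)
Lemma dense_tail (x : pt) (e : R) N : E x -> 0 < e ->
  exists2 k, (N <= k)%N & `|x - d k| < e.
Proof.
move=> Ex e0; apply: contrapT => nk.
have kN k : `|x - d k| < e -> (k < N)%N.
  by move=> xk; rewrite ltnNge; apply/negP => Nk; apply: nk; exists k.
have pt_closed (y : pt) : closed [set y].
  by apply: accessible_closed_set1; exact/hausdorff_accessible/norm_hausdorff.
pose F := \bigcup_(k in `I_N) [set d k].
have cF : closed F by apply: closed_bigcup.
have EF y : E y -> `|x - y| < e -> F y.
  move=> Ey xy; apply: contrapT => nFy.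
  have nF : nbhs y (~` F) by apply: open_nbhs_nbhs; split=> //; exact: closed_openC.
  have nB : nbhs y (ball x e).
    by apply: open_nbhs_nbhs; split; [exact: ball_open | rewrite -ball_normE].
  have [_ [[k _ <-] [nFk]]] := d_dense Ey (filterI nF nB).
  by rewrite -ball_normE/= => /kN kk; apply: nFk; exists k.
(* Removing [F'] from the ball leaves no point of [E] other than [x]. *)
pose F' := \bigcup_(k in [set k | (k < N)%N /\ d k <> x]) [set d k].
have cF' : closed F'.
  apply: closed_bigcup => //; apply: sub_finite_set (finite_II N) => k [].
  exact.
pose x' : set_type E := SigSub (mem_set Ex).
have xE : [set x'] = [set: set_type E].
  apply: E_connected; first by exists x'.
  - exists (set_val @^-1` (ball x e `&` ~` F')).
      apply: open_comp; first by move=> z _; exact: set_val_continuous.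
      by apply: openI; [exact: ball_open | exact: closed_openC].
    rewrite setTI; apply/seteqP; split=> [_ ->|z [xz nF'z]] /=.
      split; first exact: ballxx.
      by move=> [k [_ kx] /= xk]; apply: kx.
    apply: val_inj; apply: contrapT => zx.
    move: xz; rewrite -ball_normE/= => /(EF _ (set_valP z))[k kN' /= zk].
    by apply: nF'z; exists k => //; split=> // kx; apply: zx; exact: etrans zk kx.
  - exists (set_val @^-1` [set x]).
      by apply: closed_comp => // z _; exact: set_val_continuous.
    rewrite setTI; apply/seteqP; split=> [_ ->//|z /= zx].
    exact: val_inj.
have [a [b ab]] := E_nontrivial; apply: ab.
have : [set x'] a by rewrite xE.
have : [set x'] b by rewrite xE.
by move=> -> ->.
Qed.

Lemma small_cube_near (x : pt) (e : R) : E x -> 0 < e ->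
  exists k, forall y, I3 y -> `|x - phi k y| < e.
Proof.
move=> Ex e0; have e4 : 0 < e / 4 by lra.
have [N NP] := ratio_small e4; have [k /NP rk xk] := dense_tail N Ex e4.
exists k => y yI; have := phi_near k yI; have := ler_distD (d k) x (phi k y).
rewrite (distrC (d k)); lra.
Qed.

(** A point of E is near arbitrarily small cubes.  A point [phi k y] inherits
    from [y] the images by [phi k] of the copies near [y], and [phi k] contracts
    by a factor of at least 2.  At scale 1 any cube other than the one that
    contains the point will do. *)
Lemma small_copy n (x : pt) : X x -> exists p : pt -> pt,
  [/\ continuous p, injective p,
      exists2 G, open G & p @` X = X `&` G,
      ~ (p @` X) x &
      forall y, X y -> `|x - p y| <= 2 ^- n].
Proof.
have near_E m (y : pt) : E y ->
    exists k, forall z, X z -> `|y - phi k z| <= 2 ^- m.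
  move=> Ey; have m0 : 0 < 2 ^- m :> R by rewrite invr_gt0 exprn_gt0.
  have [k kP] := small_cube_near Ey m0; exists k => z /limit_set_unit_cube zI.
  exact/ltW/kP.
elim: n x => [|n IH] x; rewrite {1}limit_set_refine => -[Ex|[k _ [y Xy <-]]].
- have [k kP] := near_E 0%N _ Ex; exists (phi k); split=> //.
  + exact: phi_continuous.
  + exact: phi_inj.
  + exact: phi_limit_set_open.
  + by move=> [z /limit_set_unit_cube zI zx]; apply: (@phi_not_E k z); rewrite ?zx.
- exists (phi k.+1); split=> //.
  + exact: phi_continuous.
  + exact: phi_inj.
  + exact: phi_limit_set_open.
  + move=> [z /limit_set_unit_cube zI zy].
    have := phi_disjoint zI (limit_set_unit_cube Xy) zy; lia.
  + move=> z /limit_set_unit_cube/(phi_unit_cube k.+1)/unit_cubeP zI.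
    have /(phi_unit_cube k)/unit_cubeP yI := limit_set_unit_cube Xy.
    rewrite expr0 invr1; apply: norm_le_coord => // i.
    move: (zI i) (yI i).
    have -> : (phi k y - phi k.+1 z) 0 i = phi k y 0 i - phi k.+1 z 0 i.
      by rewrite [LHS]mxE [X in _ + X]mxE.
    rewrite !ler_norml; lra.
- have [k kP] := near_E n.+1 _ Ex; exists (phi k); split=> //.
  + exact: phi_continuous.
  + exact: phi_inj.
  + exact: phi_limit_set_open.
  + by move=> [z /limit_set_unit_cube zI zx]; apply: (@phi_not_E k z); rewrite ?zx.
- have [p [cp ip [G oG pG] px pn]] := IH y Xy; exists (phi k \o p); split.
  + by move=> z; apply: continuous_comp; [exact: cp | exact: phi_continuous].
  + by apply: inj_comp; [exact: phi_inj | exact: ip].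
  + have [H oH kH] := phi_limit_set_open k.
    exists (H `&` phi k @` G); first by apply: openI => //; exact: phi_open.
    rewrite -image_comp pG setIA -kH; apply/seteqP.
    split=> [_ [z [Xz Gz] <-]|_ [[z Xz <-]]].
      by split; exists z.
    by move=> [w Gw /phi_inj zw]; exists z => //; split=> //; rewrite -zw.
  + by move=> [z Xz /phi_inj zy]; apply: px; exists z.
  + move=> z Xz /=; rewrite phiB normrZ gtr0_norm ?ratio_gt0//.
    rewrite exprS invfM; have := pn z Xz; have := ratio_gt0 k; have := ratio_le4 k.
    have : 0 < 2 ^- n :> R by rewrite invr_gt0 exprn_gt0.
    set a := 2 ^- n; set b := `|_|; have : 0 <= b by exact: normr_ge0.
    nra.
Qed.

Lemma limit_set_copies : copies_near_points (set_type X).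
Proof.
move=> x O [_ [[V oV <-] Vx VO]].
have : nbhs (set_val x) V by exact: open_nbhs_nbhs.
move=> /nbhs_ballP[e/= e0 eV].
have [n ne] : exists n, 2 ^- n < e :> R.
  have [N NP] := ratio_small e0; exists (2 * N.+1)%N; exact: NP.
have [p [cp ip [G oG pG] px pn]] := small_copy n (set_valP x).
have pX (y : set_type X) : (X `&` G) (p (set_val y)).
  by rewrite -pG; exists (set_val y) => //; exact: set_valP.
exists (fun y => SigSub (mem_set (pX y).1)); split.
- apply: continuous_comp_initial => y.
  by apply: (@continuous_comp _ _ _ set_val p); [exact: set_val_continuous | exact: cp].
- by move=> y z /(congr1 val)/= /ip/val_inj.
- rewrite [B in open B](_ : _ = set_val @^-1` G).
    by apply: open_comp => // y _; exact: set_val_continuous.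
  apply/seteqP; split=> [_ [y _ <-]|y Gy]; first by have [] := pX y.
  have [z Xz zy] : (p @` X) (set_val y) by rewrite pG; split=> //; exact: set_valP.
  by exists (SigSub (mem_set Xz)) => //; apply: val_inj.
- move=> _ [y _ <-]; split; last first.
    by move=> yx; apply: px; exists (set_val y); [exact: set_valP | rewrite -yx].
  apply: VO; apply: eV; rewrite -ball_normE/=.
  exact: le_lt_trans (pn _ (set_valP y)) ne.
Qed.

End Dense.
End Geometry.

Theorem theorem6p8 (R : realType) (E : set 'rV[R]_3) (d : nat -> 'rV[R]_3)
    (E_planar : E `<=` middle_square R)
    (E_continuum : continuum R (set_type E))
    (E_nontrivial : nontrivial_space (set_type E))
    (d_in_E : range d `<=` E)
    (d_dense : E `<=` closure (range d)) :
  let X := set_type (limit_set (fun _ : seq nat => E) (fun _ : seq nat => d)) in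
  [/\ ~ reconstructible X, compact [set: X], metrizable R X & h_homogeneous X].
Proof.
move=> X; have [E_compact E_connected _] := E_continuum.
have E_closed : closed E.
  apply: compact_closed; first exact: norm_hausdorff.
  have -> : E = set_val @` [set: set_type E].
    apply/seteqP; split=> [x Ex|_ [x _ <-]]; last exact: set_valP.
    by exists (SigSub (mem_set Ex)).
  by apply: continuous_compact E_compact; apply/continuous_subspaceT/set_val_continuous.
have hX : hausdorff_space X by exact: metric_hausdorff.
have cX : compact [set: X].
  exact/compact_set_type/limit_set_compact.
have copies : copies_near_points X by exact: limit_set_copies.
have X0 : [set: X] !=set0.
  have [e _] := E_nontrivial.
  by exists (SigSub (mem_set (E_limit_set E_planar d_in_E (set_valP e)))).
split=> //.
- exact: not_reconstructible_copies.
- exact: set_type_metrizable.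
- exact: h_homogeneous_copies.
Qed.
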